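(* For all integers $m \geq 4$ and $k \geq 3$, $\mathrm{rotdim}(G(m,k)) = m+1$, where $G(m,k)$ is the graph on vertex set $\{1,\dots,m+k\}$ in which $\{1,\dots,m\}$ forms a complete graph $K_m$, each of $m+1,\dots,m+k$ is adjacent to all of $1,\dots,m$, and no two of $m+1,\dots,m+k$ are adjacent.
   Context: For a finite simple undirected graph $G=(V,E)$ with $V=\{1,\dots,n\}$, vertex weight $s: V \to \mathbb{R}_{\geq 0}$ and edge length $l: E \to \mathbb{R}_{\geq 0}$, consider the problem: maximize $\sum_{i \in V} s(i)\|\mathbf{v}(i)\|^2$ over maps $\mathbf{v}: V \to \mathbb{R}^n$ subject to $\sum_{i \in V} s(i)\mathbf{v}(i) = 0$ and $\|\mathbf{v}(i)-\mathbf{v}(j)\| \leq l(ij)$ for all $ij \in E$; optimal solutions are optimal embeddings. $\mathrm{rotdim}_G(s,l) := \min\{\dim \mathrm{span}\{\mathbf{v}(i) : i \in V\} : \mathbf{v}\text{ optimal}\}$ and, for connected $G$, $\mathrm{rotdim}(G) := \max\{\mathrm{rotdim}_G(s,l) : s: V \to \mathbb{Z}_{\geq 0},\ l: E \to \mathbb{Z}_{\geq 0}\}$ (the rotational dimension). *)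

(* Defs.v *)
From mathcomp Require Import all_boot all_order all_algebra.
From mathcomp Require Import boolp classical_sets reals.

Set Implicit Arguments.
Unset Strict Implicit.
Unset Printing Implicit Defensive.

Import Order.TTheory GRing.Theory Num.Theory.
Local Open Scope ring_scope.

Record sgraph (n : nat) := SGraph {
  adj :> rel 'I_n;
  adj_sym : symmetric adj;
  adj_irr : irreflexive adj
}.

(* The canonical norm on 'rV[R]_n in MathComp-Analysis is the sup norm, hence *)
(* a separate definition of the Euclidean norm.                               *)
Definition enorm (R : realType) (n : nat) (u : 'rV[R]_n) : R :=
  Num.sqrt (\sum_(j < n) u ord0 j ^+ 2).

Section Embeddings.
Variables (R : realType) (n : nat) (G : sgraph n).

(* Edge lengths are functions of the unordered pair {i, j}; their values      *)
(* outside the edge set of G are never used.                                  *)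
Implicit Types (s : 'I_n -> R) (l : {set 'I_n} -> R) (v : 'I_n -> 'rV[R]_n).

Definition feasible s l v : Prop :=
  \sum_i s i *: v i = 0 /\
  (forall i j : 'I_n, adj G i j -> enorm (v i - v j) <= l [set i; j]%SET).

Definition objective s v : R := \sum_i s i * enorm (v i) ^+ 2.

Definition optimal s l v : Prop :=
  feasible s l v /\
  (forall w : 'I_n -> 'rV[R]_n, feasible s l w -> objective s w <= objective s v).

Definition dim_span v : nat := \dim <<codom v>>%VS.

End Embeddings.

Definition is_min (A : nat -> Prop) (d : nat) : Prop :=
  A d /\ (forall d' : nat, A d' -> (d <= d')%N).

Definition is_max (A : nat -> Prop) (d : nat) : Prop :=
  A d /\ (forall d' : nat, A d' -> (d' <= d)%N).

(* The minimum exists as soon as an optimal embedding does (for nonnegative   *)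
(* s, l this is the case whenever G is connected); otherwise the value is 0.  *)
Definition rotdim_at (R : realType) (n : nat) (G : sgraph n)
    (s : 'I_n -> R) (l : {set 'I_n} -> R) : nat :=
  xget 0%N (is_min (fun d => exists2 v, optimal G s l v & d = dim_span v)).

(* Meant for connected G. The maximum always exists, since dim_span v <= n.   *)
Definition rotdim (R : realType) (n : nat) (G : sgraph n) : nat :=
  xget 0%N (is_max (fun d =>
    exists (s : 'I_n -> nat) (l : {set 'I_n} -> nat),
      d = rotdim_at G (fun i => (s i)%:R : R) (fun e => (l e)%:R : R))).

(* The vertices 1, ..., m + k are numbered 0, ..., m + k - 1: those below m   *)
(* form the clique, the other k are pairwise nonadjacent.                     *)
Definition Gmk_adj (m k : nat) : rel 'I_(m + k) :=
  fun i j => (i != j) && ((i < m)%N || (j < m)%N).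

Lemma Gmk_sym (m k : nat) : symmetric (@Gmk_adj m k).
Proof. by move=> i j; rewrite /Gmk_adj eq_sym orbC. Qed.

Lemma Gmk_irr (m k : nat) : irreflexive (@Gmk_adj m k).
Proof. by move=> i; rewrite /Gmk_adj eqxx. Qed.

Definition Gmk (m k : nat) : sgraph (m + k) :=
  SGraph (@Gmk_sym m k) (@Gmk_irr m k).

(* Main.v *)
Require Import Defs.
From mathcomp Require Import all_boot all_order all_algebra.
From mathcomp Require Import boolp classical_sets reals.
From mathcomp Require Import ring lra.

(** Upper bound. Translate so that a clique vertex is at the origin; the clique
    then spans a space A of dimension at most m - 1. The edge constraints see
    only the components of the other vertices in A and the norms of their
    components in the orthogonal complement of A, and the centred objective sees
    in addition only the norm of the weighted sum of the latter. The orthogonal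
    components can be replaced by vectors of a plane with the same norms and the
    same norm of the weighted sum, so dimension m + 1 always suffices.

    Lower bound. Take all lengths 1, weight m + 3 on the clique, m on three of the
    other vertices and 0 on the remaining ones. The sum of the squared lengths of
    the edges between weighted vertices exceeds the objective by
    (m + 6) / m * |C|^2, where C is the sum of the clique vectors. Hence at an
    optimum C = 0 and all these edges have length 1, so the clique is a regular
    simplex centred at the origin and the three other vertices form an
    equilateral triangle in its orthogonal complement: the dimension is
    (m - 1) + 2. *)

Set Implicit Arguments.
Unset Strict Implicit.
Unset Printing Implicit Defensive.

Import Order.TTheory GRing.Theory Num.Theory.
Local Open Scope ring_scope.

(** * Euclidean inner product on row vectors *)

Section InnerProduct.
Variables (R : realType) (N : nat).
Implicit Types (u v w : 'rV[R]_N) (c : R).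

Definition dot u v : R := \sum_j u ord0 j * v ord0 j.

Lemma dotC u v : dot u v = dot v u.
Proof. by apply: eq_bigr => j _; rewrite mulrC. Qed.

Lemma dotDl u v w : dot (u + v) w = dot u w + dot v w.
Proof. by rewrite -big_split; apply: eq_bigr => j _; rewrite mxE mulrDl. Qed.

Lemma dotZl c u w : dot (c *: u) w = c * dot u w.
Proof. by rewrite mulr_sumr; apply: eq_bigr => j _; rewrite mxE mulrA. Qed.

Lemma dotDr u v w : dot w (u + v) = dot w u + dot w v.
Proof. by rewrite dotC dotDl !(dotC w). Qed.

Lemma dotZr c u w : dot w (c *: u) = c * dot w u.
Proof. by rewrite dotC dotZl dotC. Qed.

Lemma dotNl u w : dot (- u) w = - dot u w.
Proof. by rewrite -scaleN1r dotZl mulN1r. Qed.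

Lemma dotNr u w : dot w (- u) = - dot w u.
Proof. by rewrite dotC dotNl dotC. Qed.

Lemma dot0l w : dot 0 w = 0.
Proof. by rewrite -(scale0r w) dotZl mul0r. Qed.

Lemma dot0r w : dot w 0 = 0.
Proof. by rewrite dotC dot0l. Qed.

Lemma dot_suml (I : finType) (F : I -> 'rV[R]_N) w :
  dot (\sum_i F i) w = \sum_i dot (F i) w.
Proof.
by apply: (big_morph (dot^~ w)) => [u v|]; [exact: dotDl | exact: dot0l].
Qed.

Lemma dot_sumr (I : finType) (F : I -> 'rV[R]_N) w :
  dot w (\sum_i F i) = \sum_i dot w (F i).
Proof. by rewrite dotC dot_suml; apply: eq_bigr => i _; rewrite dotC. Qed.

Definition dotE := (dotDl, dotDr, dotNl, dotNr, dotZl, dotZr).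

Lemma dot_sub u v : dot (u - v) (u - v) = dot u u + dot v v - 2 * dot u v.
Proof. by rewrite !dotE (dotC v u); ring. Qed.

Lemma dot_ge0 u : 0 <= dot u u.
Proof. by apply: sumr_ge0 => j _; rewrite -expr2 sqr_ge0. Qed.

Lemma dot_eq0 u : dot u u = 0 -> u = 0.
Proof.
move=> /psumr_eq0P u0; apply/rowP => j; rewrite mxE; apply/eqP.
by rewrite -sqrf_eq0 expr2 u0 // => i _; rewrite -expr2 sqr_ge0.
Qed.

(** Cauchy-Schwarz: the squared norm of |u|^2 v - <u,v> u equals |u|^2 times the difference of the
    two sides. *)
Lemma dot_sqr_le u v : dot u v ^+ 2 <= dot u u * dot v v.
Proof.
have := dot_ge0 (dot u u *: v - dot u v *: u).
rewrite !dotE (dotC v u) => h.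
have [/dot_eq0 ->|u0] := eqVneq (dot u u) 0; first by rewrite !dot0l expr0n mul0r.
have up : 0 < dot u u by rewrite lt_def u0 dot_ge0.
rewrite -(ler_pM2l up); lra.
Qed.

Lemma enorm_sqr u : enorm u ^+ 2 = dot u u.
Proof.
rewrite /enorm sqr_sqrtr; first by apply: eq_bigr => j _; rewrite expr2.
by apply: sumr_ge0 => j _; rewrite sqr_ge0.
Qed.

Lemma enorm_le u c : 0 <= c -> (enorm u <= c) = (dot u u <= c ^+ 2).
Proof.
by move=> c0; rewrite -enorm_sqr ler_pXn2r // nnegrE // sqrtr_ge0.
Qed.

Lemma dot_delta u j : dot u (delta_mx 0 j) = u ord0 j.
Proof.
rewrite /dot (bigD1 j) //= big1 ?addr0 => [|i ij].
  by rewrite mxE !eqxx mulr1.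
by rewrite mxE eqxx (negPf ij) mulr0.
Qed.

Lemma dot_lincomb (I : finType) (s : I -> R) (x : I -> 'rV[R]_N) :
  dot (\sum_i s i *: x i) (\sum_i s i *: x i)
    = \sum_i \sum_j s i * s j * dot (x i) (x j).
Proof.
rewrite dot_suml; apply: eq_bigr => i _; rewrite dot_sumr.
by apply: eq_bigr => j _; rewrite dotZl dotZr mulrA.
Qed.

Lemma objective_dot (s : 'I_N -> R) (v : 'I_N -> 'rV[R]_N) :
  objective s v = \sum_i s i * dot (v i) (v i).
Proof. by apply: eq_bigr => i _; rewrite enorm_sqr. Qed.

End InnerProduct.

(** * Upper bound: reducing the dimension of a feasible embedding *)

Section DimensionReduction.
Variable R : realType.

(** A circle of squared radius [q] meets the line a x + b y = c, whose distance from the origin is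
    at most the radius by hypothesis. When (a, b) = 0, the hypothesis forces c = 0. *)
Lemma plane_point (a b c q : R) : 0 <= q -> c ^+ 2 <= (a ^+ 2 + b ^+ 2) * q ->
  exists p : R * R, p.1 ^+ 2 + p.2 ^+ 2 = q /\ a * p.1 + b * p.2 = c.
Proof.
move=> q0; set T := a ^+ 2 + b ^+ 2 => hc.
have [T0|T0] := eqVneq T 0.
  move/eqP: (T0); rewrite paddr_eq0 ?sqr_ge0 // !sqrf_eq0 => /andP[/eqP-> /eqP->].
  exists (Num.sqrt q, 0); rewrite /= sqr_sqrtr // expr0n addr0; split=> //.
  move: hc; rewrite T0 mul0r => c0; rewrite !mul0r addr0; apply/esym/eqP.
  by rewrite -sqrf_eq0 eq_le c0 sqr_ge0.
pose d := Num.sqrt (T * q - c ^+ 2).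
have hd : d ^+ 2 = T * q - c ^+ 2 by rewrite sqr_sqrtr // subr_ge0.
(* The foot of the perpendicular from the origin, c (a, b) / T, moved along the line by d (-b, a) /
   T. *)
exists ((c * a - d * b) / T, (c * b + d * a) / T) => /=; split.
  have -> : ((c * a - d * b) / T) ^+ 2 + ((c * b + d * a) / T) ^+ 2
     = (c ^+ 2 + d ^+ 2) * T / T ^+ 2 by rewrite /T; field.
  by rewrite hd; field.
by rewrite [RHS](_ : c = c * T / T) ?mulfK // /T; field.
Qed.

(* The planar vectors are chosen one at a time, each reproducing the inner
   product of the original vector with the preceding partial sum. *)
Lemma planar_rearrangement (N : nat) (I : finType) (s : I -> R)
    (w : I -> 'rV[R]_N) :
  exists a b : I -> R, (forall i, a i ^+ 2 + b i ^+ 2 = dot (w i) (w i)) /\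
    (\sum_i s i * a i) ^+ 2 + (\sum_i s i * b i) ^+ 2
      = dot (\sum_i s i *: w i) (\sum_i s i *: w i).
Proof.
elim: (index_enum I) (index_enum_uniq I) => [_|x r IHr /= /andP[xr /IHr]].
  exists (fun i => Num.sqrt (dot (w i) (w i))), (fun=> 0); split=> [i|].
    by rewrite sqr_sqrtr ?dot_ge0 // expr0n addr0.
  by rewrite !big_nil dot0l !expr0n addr0.
move=> [a [b [hab hs]]]; rewrite big_cons.
set S := \sum_(i <- r) s i *: w i in hs *.
set A := \sum_(i <- r) _ in hs; set B := \sum_(i <- r) _ in hs.
have [|[p q] /= [hp hq]] := @plane_point A B (dot S (w x)) _ (dot_ge0 (w x)).
  by rewrite hs dot_sqr_le.
exists (fun i => if i == x then p else a i), (fun i => if i == x then q else b i).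
split=> [i|]; first by case: eqP => // ->.
have upd (c : R) (f : I -> R) :
    \sum_(i <- x :: r) s i * (if i == x then c else f i)
      = s x * c + \sum_(i <- r) s i * f i.
  rewrite big_cons eqxx; congr (_ + _); apply: eq_big_seq => i ir.
  by case: eqP => // ix; rewrite -ix ir in xr.
rewrite !upd -/A -/B !dotE (dotC (w x) S) -hs -hq -hp; ring.
Qed.

(** Gram-Schmidt on the first [r] vectors: [y] records the components along the orthonormal vectors
    found, written in the first [r] coordinates, and [z] is the orthogonal remainder. Only inner
    products are preserved. *)
Lemma gram_split (N n r : nat) (x : 'I_n -> 'rV[R]_N) : (r <= N)%N ->
  exists y z : 'I_n -> 'rV[R]_N,
  [/\ forall i (j : 'I_N), (r <= j)%N -> y i ord0 j = 0,
      forall i : 'I_n, (i < r)%N -> z i = 0 &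
      forall i j, dot (x i) (x j) = dot (y i) (y j) + dot (z i) (z j)].
Proof.
elim: r => [_|r IHr rN].
  by exists (fun=> 0), x; split=> // [i j _|i j]; rewrite ?mxE // dot0l add0r.
have [y [z [hy hz hG]]] := IHr (ltnW rN).
have [rn|nr] := ltnP r n; last first.
  exists y, z; split=> // [i j /ltnW|i _]; first exact: hy.
  by apply: hz; apply: leq_trans (ltn_ord i) nr.
pose u := z (Ordinal rn); pose e : 'rV[R]_N := delta_mx 0 (Ordinal rN).
have [u0|u0] := eqVneq u 0.
  exists y, z; split=> // [i j /ltnW|i]; first exact: hy.
  rewrite ltnS leq_eqVlt => /orP[/eqP ir|]; last exact: hz.
  by rewrite -u0; congr z; apply: val_inj.
have uu : dot u u != 0 by apply: contra_neq u0 => /dot_eq0.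
pose d := Num.sqrt (dot u u).
have dd : d ^+ 2 = dot u u by rewrite sqr_sqrtr ?dot_ge0.
have d0 : d != 0 by rewrite -sqrf_eq0 dd.
(* The component along the unit vector u / d moves from [z] to the new coordinate [r] of [y]. *)
exists (fun i => y i + (dot (z i) u / d) *: e),
       (fun i => z i - (dot (z i) u / dot u u) *: u); split.
- move=> i j rj; rewrite !mxE hy ?(ltnW rj) // add0r.
  suff -> : (j == Ordinal rN) = false by rewrite andbF mulr0.
  by apply/negbTE/eqP => jr; rewrite jr /= ltnn in rj.
- move=> i; rewrite ltnS leq_eqVlt => /orP[/eqP ir|ir]; last first.
    by rewrite hz // dot0l mul0r scale0r subr0.
  by rewrite (_ : i = Ordinal rn) ?divff ?scale1r ?subrr //; apply: val_inj.
- move=> i j; rewrite hG !dotE (dotC e) !dot_delta !hy //.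
  by rewrite mxE !eqxx /= !(dotC u) -dd; field; exact: d0.
Qed.

Lemma dim_span_le (n d : nat) (v : 'I_n -> 'rV[R]_n) :
  (forall i (j : 'I_n), (d <= j)%N -> v i ord0 j = 0) -> (Defs.dim_span v <= d)%N.
Proof.
case: n v => [|n] v hv.
  rewrite /Defs.dim_span (_ : codom v = [::]) ?span_nil ?dimv0 //.
  by apply: size0nil; rewrite size_codom card_ord.
pose X : seq 'rV[R]_n.+1 := [seq delta_mx 0 (inord t) | t <- iota 0 d].
apply: (@leq_trans (size X)); last by rewrite size_map size_iota.
apply: leq_trans (dim_span X); apply: dimvS; apply/span_subvP => _ /codomP[i ->].
rewrite [v i]row_sum_delta; apply: memv_suml => j _.
have [dj|jd] := leqP d j; first by rewrite hv // scale0r mem0v.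
apply/memvZ/memv_span/mapP; exists (val j); first by rewrite mem_iota.
by rewrite inord_val.
Qed.

(** * Centring at the weighted barycentre *)

Section Centering.
Variables (N : nat) (I : finType) (s : I -> R).
Implicit Types z : I -> 'rV[R]_N.

Let W := \sum_i s i.
Hypothesis W0 : W != 0.

Definition center z i := z i - W^-1 *: \sum_j s j *: z j.

Lemma sum_center z : \sum_i s i *: center z i = 0.
Proof.
under eq_bigr do rewrite scalerBr.
by rewrite sumrB -scaler_suml scalerA divff // scale1r subrr.
Qed.

(** Parallel axis identity. The objective after centring thus depends on [z] only through the norms
    and the norm of the weighted sum. *)
Lemma sum_center_sqr z :
  \sum_i s i * dot (center z i) (center z i) = \sum_i s i * dot (z i) (z i)
    - W^-1 * dot (\sum_i s i *: z i) (\sum_i s i *: z i).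
Proof.
rewrite /center; set S := \sum_i s i *: z i.
transitivity (\sum_i (s i * dot (z i) (z i) - (2 / W) * dot (s i *: z i) S
    + s i * (W^-2 * dot S S))).
  by apply: eq_bigr => i _; rewrite !dotE (dotC S); field.
rewrite !big_split /= sumrN -mulr_sumr -mulr_suml -dot_suml -/S -/W.
by field.
Qed.

Lemma center_id z c : \sum_i s i *: z i = 0 -> center (fun i => z i - c) =1 z.
Proof.
move=> z0 i; rewrite /center; under eq_bigr do rewrite scalerBr.
rewrite sumrB z0 sub0r -scaler_suml scalerN scalerA mulVf // scale1r.
by rewrite opprK subrK.
Qed.

End Centering.

Lemma dim_reduction (m k : nat) (s : 'I_(m.+1 + k.+1) -> R) l v :
  (forall i, 0 <= s i) -> (forall e, 0 <= l e) ->
  feasible (Gmk m.+1 k.+1) s l v ->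
  exists v', [/\ feasible (Gmk m.+1 k.+1) s l v',
                 objective s v' = objective s v & (Defs.dim_span v' <= m.+2)%N].
Proof.
(* With total weight zero all weights vanish, and the zero embedding serves. *)
move=> s0 l0 [vs vl]; have [W0|W0] := eqVneq (\sum_i s i) 0.
  have {W0}s00 i : s i = 0 by move/psumr_eq0P: W0; apply.
  exists (fun=> 0); split.
  - split=> [|i j _]; first by rewrite big1 // => i _; rewrite scaler0.
    by rewrite subrr enorm_le // dot0l sqr_ge0.
  - by rewrite /objective !big1 // => i _; rewrite s00 mul0r.
  - by apply: dim_span_le => i j _; rewrite mxE.
have mN : (m < m.+1 + k.+1)%N by rewrite ltn_addr.
have m1N : (m.+1 < m.+1 + k.+1)%N by rewrite addnS ltnS leq_addr.
(* The last clique vertex goes to the origin, so the first [m] vectors, those processed by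
   [gram_split], are exactly the remaining clique vertices. *)
pose b0 := Ordinal mN; pose x i := v i - v b0.
have [y [z [hy hz hG]]] := gram_split x (ltnW mN).
have zclique (i : 'I_(m.+1 + k.+1)) : (i < m.+1)%N -> z i = 0.
  rewrite ltnS leq_eqVlt => /orP[/eqP im|]; last exact: hz.
  have -> : i = b0 by apply: val_inj.
  apply: dot_eq0; have := hG b0 b0; rewrite /x subrr dot0l.
  have := dot_ge0 (y b0); have := dot_ge0 (z b0); lra.
have [a [b [hab hsab]]] := planar_rearrangement s z.
(* [y] occupies coordinates 0 to m - 1, so coordinates m and m + 1 are free for the plane. *)
pose e1 : 'rV[R]_(m.+1 + k.+1) := delta_mx 0 (Ordinal mN).
pose e2 : 'rV[R]_(m.+1 + k.+1) := delta_mx 0 (Ordinal m1N).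
pose w i := y i + a i *: e1 + b i *: e2.
have wG i j : dot (w i) (w j) = dot (y i) (y j) + a i * a j + b i * b j.
  rewrite /w !dotE !(dotC e1) !(dotC e2) !dot_delta !hy //.
  rewrite !mxE !eqxx /= -!val_eqE /= !eqn_leq ltnn leqnSn /=; ring.
have wS : dot (\sum_i s i *: w i) (\sum_i s i *: w i)
        = dot (\sum_i s i *: x i) (\sum_i s i *: x i).
  have -> : dot (\sum_i s i *: x i) (\sum_i s i *: x i)
      = dot (\sum_i s i *: y i) (\sum_i s i *: y i)
        + dot (\sum_i s i *: z i) (\sum_i s i *: z i).
    rewrite !dot_lincomb -big_split; apply: eq_bigr => i _; rewrite -big_split.
    by apply: eq_bigr => j _; rewrite hG mulrDr.
  rewrite -hsab !expr2 !big_distrlr !dot_lincomb -!big_split.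
  apply: eq_bigr => i _; rewrite -!big_split; apply: eq_bigr => j _.
  by rewrite wG /=; ring.
exists (center s w); split.
- split=> [|i j ij]; first exact: sum_center.
  have := vl i j ij; rewrite !enorm_le //; apply: le_trans.
  have -> : v i - v j = x i - x j by rewrite /x opprB addrA subrK.
  have -> : center s w i - center s w j = w i - w j.
    by rewrite /center opprB addrA subrK.
  rewrite (dot_sub (w i)) (dot_sub (x i)) !wG !hG -!hab.
  have zab t : z t = 0 -> a t = 0 /\ b t = 0.
    move=> zt; have := hab t; rewrite zt dot0l => /eqP.
    by rewrite paddr_eq0 ?sqr_ge0 // !sqrf_eq0 => /andP[/eqP-> /eqP->].
  (* Every edge has a clique end, where [z], [a] and [b] vanish, so the cross terms drop out on both
     sides. *)
  by case/andP: ij => _ /orP[] /zclique zt; have [-> ->] := zab _ zt;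
    rewrite zt ?dot0l ?dot0r; lra.
- rewrite !objective_dot sum_center_sqr // wS.
  (* [x] is a translate of the centred [v], so centring it gives back [v]. *)
  transitivity (\sum_i s i * dot (center s x i) (center s x i)).
    rewrite sum_center_sqr //; congr (_ - _); apply: eq_bigr => i _.
    by rewrite wG hG -hab !expr2 addrA.
  by apply: eq_bigr => i _; rewrite center_id.
- apply: dim_span_le => i j mj; rewrite /center mxE.
  have wj t : w t ord0 j = 0.
    have mj' : (m < j)%N by apply: leq_trans mj.
    rewrite !mxE hy ?(ltnW mj') //= -!val_eqE /=.
    by rewrite (gtn_eqF mj') (gtn_eqF mj) !mulr0 !addr0.
  rewrite wj !mxE summxE [X in _ * X]big1 ?mulr0 ?subr0 // => t _.
  by rewrite mxE wj mulr0.
Qed.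

End DimensionReduction.

(** * Lower bound: regular simplices *)

Section Example.
Variable R : realType.

(** Testing against [ord0] makes the sum of the coefficients zero; testing against [lift ord0 i]
    then isolates [c i]. *)
Lemma simplex_indep (N : nat) (c : 'I_N -> R) (b : R) : b != 0 ->
  (forall j, \sum_i c i * ((lift ord0 i == j)%:R - b) = 0) ->
  forall i, c i = 0.
Proof.
move=> b0 h.
have hj j : \sum_i c i * (lift ord0 i == j)%:R = b * \sum_i c i.
  apply/eqP; rewrite -subr_eq0 mulr_sumr -sumrB -[X in _ == X](h j).
  by apply/eqP; apply: eq_bigr => i _; rewrite mulrBr (mulrC b).
have c0 : \sum_i c i = 0.
  have /eqP := hj ord0; rewrite big1 => [|i _]; last by rewrite mulr0.
  by rewrite eq_sym mulf_eq0 (negPf b0) => /eqP.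
move=> i; have := hj (lift ord0 i); rewrite c0 mulr0 (bigD1 i) //= eqxx mulr1.
rewrite big1 ?addr0 // => t ti; rewrite (inj_eq (@lift_inj _ ord0)).
by rewrite (negPf ti) mulr0.
Qed.

Lemma sum_sqr_dist (N a : nat) (x : 'rV[R]_N) (u : 'I_a -> 'rV[R]_N) :
  \sum_i dot (x - u i) (x - u i) = a%:R * dot x x
     + \sum_i dot (u i) (u i) - 2 * dot x (\sum_i u i).
Proof.
under eq_bigr do rewrite dot_sub.
rewrite !big_split /= sumr_const card_ord sumrN -mulr_sumr -dot_sumr.
by rewrite -[_ *+ a]mulr_natl.
Qed.

Lemma psumr2_eq0 (I J : finType) (F : I -> J -> R) :
  (forall i j, 0 <= F i j) -> \sum_i \sum_j F i j = 0 -> forall i j, F i j = 0.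
Proof.
move=> F0 /psumr_eq0P h i j.
by apply: (psumr_eq0P _ (h _ i isT)) => // i' _; apply: sumr_ge0.
Qed.

(** The two Gram matrices are those of regular simplices centred at the origin, up to scaling, in
    orthogonal spaces. The vertices of each sum to zero; dropping one vertex from each leaves
    independent vectors. *)
Lemma dim_simplices_ge (n a b : nat) (v : 'I_n -> 'rV[R]_n)
    (f : 'I_a.+1 -> 'I_n) (g : 'I_b.+1 -> 'I_n) (p q : R) :
  p != 0 -> q != 0 ->
  (forall i j, dot (v (f i)) (v (f j)) = p * ((i == j)%:R - a.+1%:R^-1)) ->
  (forall i j, dot (v (g i)) (v (g j)) = q * ((i == j)%:R - b.+1%:R^-1)) ->
  (forall i j, dot (v (f i)) (v (g j)) = 0) ->
  (a + b <= Defs.dim_span v)%N.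
Proof.
move=> p0 q0 hf hg hfg.
pose F (t : 'I_(a + b)) := match split t with
  | inl i => v (f (lift ord0 i)) | inr j => v (g (lift ord0 j)) end.
pose X := [tuple F t | t < a + b].
suff /eqP fX : free X.
  rewrite -[X in (X <= _)%N](size_tuple X) -fX; apply/dimvS/sub_span => x.
  move=> /mapP[t _ ->]; rewrite /F.
  by case: split => ?; apply: codom_f.
apply/freeP => c h.
have {}h : \sum_i c (lshift b i) *: v (f (lift ord0 i))
      + \sum_j c (rshift a j) *: v (g (lift ord0 j)) = 0.
  rewrite -[RHS]h [RHS](eq_bigr (fun t => c t *: F t)) => [|t _]; last first.
    by rewrite -tnth_nth tnth_mktuple.
  rewrite big_split_ord /=; congr (_ + _); apply: eq_bigr => i _; rewrite /F.
    by rewrite (unsplitK (inl i)).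
  by rewrite (unsplitK (inr i)).
have hc1 : forall i, c (lshift b i) = 0.
  apply: (@simplex_indep _ _ a.+1%:R^-1) => [|j].
    by rewrite invr_eq0 pnatr_eq0.
  apply: (mulfI p0); rewrite mulr0 mulr_sumr.
  have /(congr1 (fun x => dot x (v (f j)))) := h.
  rewrite dot0l dotDl !dot_suml [X in _ + X]big1 => [|i _]; last first.
    by rewrite dotZl dotC hfg mulr0.
  rewrite addr0 => hs; rewrite -[RHS]hs; apply: eq_bigr => i _.
  by rewrite dotZl hf mulrCA.
have hc2 : forall i, c (rshift a i) = 0.
  apply: (@simplex_indep _ _ b.+1%:R^-1) => [|j].
    by rewrite invr_eq0 pnatr_eq0.
  apply: (mulfI q0); rewrite mulr0 mulr_sumr.
  have /(congr1 (fun x => dot x (v (g j)))) := h.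
  rewrite dot0l dotDl !dot_suml [X in X + _]big1 => [|i _]; last first.
    by rewrite dotZl hfg mulr0.
  rewrite add0r => hs; rewrite -[RHS]hs; apply: eq_bigr => i _.
  by rewrite dotZl hg mulrCA.
by move=> t; rewrite -(splitK t); case: split => i; [exact: hc1 | exact: hc2].
Qed.

(** Pairing the zero sum with each vector gives three linear equations, which determine the three
    mutual inner products. *)
Lemma dot_triangle (N : nat) (x : 'I_3 -> 'rV[R]_N) (q : R) :
  \sum_i x i = 0 -> (forall i, dot (x i) (x i) = q * (2 / 3)) ->
  forall i j, dot (x i) (x j) = q * ((i == j)%:R - 3^-1).
Proof.
move=> x0 hq.
have sx : x 0 + x 1 + x 2 = 0.
  rewrite -[RHS]x0 !big_ord_recl big_ord0 addr0 addrA.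
  by congr (x _ + x _ + x _); apply: val_inj.
have h i : dot (x i) (x 0) + dot (x i) (x 1) + dot (x i) (x 2) = 0.
  by rewrite -!dotDr sx dot0r.
have := h 0; have := h 1; have := h 2.
rewrite !hq (dotC (x 1) (x 0)) (dotC (x 2) (x 0)) (dotC (x 2) (x 1)) => h2 h1 h0.
have cases (i : 'I_3) : [\/ i = 0, i = 1 | i = 2].
  by case: i => [[|[|[|]]]] // ?; [constructor 1|constructor 2|constructor 3];
    apply: val_inj.
move=> i j; case: (cases i) => ->; case: (cases j) => ->;
  rewrite ?hq ?(dotC (x 1) (x 0)) ?(dotC (x 2) (x 0)) ?(dotC (x 2) (x 1)) /=; lra.
Qed.

Section Simplex.
Variables (n N : nat) (f : 'I_N.+1 -> 'I_n) (c : R).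

(** Basis vectors indexed by the values of [f], centred and scaled; disjoint ranges thus yield
    orthogonal simplices. *)
Definition simplex (i : 'I_N.+1) : 'rV[R]_n :=
  c *: (delta_mx 0 (f i) - N.+1%:R^-1 *: \sum_t delta_mx 0 (f t)).

Lemma sum_simplex : \sum_i simplex i = 0.
Proof.
rewrite -scaler_sumr sumrB sumr_const card_ord -scaler_nat scalerA.
by rewrite divff ?pnatr_eq0 // scale1r subrr scaler0.
Qed.

Hypothesis f_inj : injective f.

Lemma dot_simplex i j :
  dot (simplex i) (simplex j) = c ^+ 2 * ((i == j)%:R - N.+1%:R^-1).
Proof.
have de (a b : 'I_N.+1) :
    dot (delta_mx 0 (f a) : 'rV[R]_n) (delta_mx 0 (f b)) = (a == b)%:R.
  by rewrite dot_delta mxE eqxx /= (inj_eq f_inj) eq_sym.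
have dS a : dot (delta_mx 0 (f a)) (\sum_t delta_mx 0 (f t) : 'rV[R]_n) = 1.
  rewrite dot_sumr (bigD1 a) //= de eqxx big1 ?addr0 // => t ta.
  by rewrite de eq_sym (negPf ta).
rewrite /simplex; set S := \sum_t _ in dS *.
have SS : dot S S = N.+1%:R.
  by rewrite {1}/S dot_suml (eq_bigr (fun=> 1)) ?sumr_const ?card_ord.
have : N.+1%:R != 0 :> R by rewrite pnatr_eq0.
by rewrite !dotE !(dotC S) SS !dS de; move: N.+1%:R => q q0; field.
Qed.

End Simplex.

Lemma dot_simplex_disjoint (n a b : nat) (f : 'I_a.+1 -> 'I_n)
    (g : 'I_b.+1 -> 'I_n) (c d : R) i j :
  (forall i j, f i != g j) -> dot (simplex f c i) (simplex g d j) = 0.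
Proof.
move=> fg.
have de a' b' : dot (delta_mx 0 (f a') : 'rV[R]_n) (delta_mx 0 (g b')) = 0.
  by rewrite dot_delta mxE eqxx /= eq_sym (negPf (fg _ _)).
have fS a' : dot (delta_mx 0 (f a')) (\sum_t delta_mx 0 (g t) : 'rV[R]_n) = 0.
  by rewrite dot_sumr big1.
have Sg b' : dot (\sum_t delta_mx 0 (f t) : 'rV[R]_n) (delta_mx 0 (g b')) = 0.
  by rewrite dot_suml big1.
have SS : dot (\sum_t delta_mx 0 (f t) : 'rV[R]_n) (\sum_t delta_mx 0 (g t)) = 0.
  by rewrite dot_suml big1.
by rewrite /simplex !dotE de fS Sg SS !(mulr0, oppr0, addr0).
Qed.

(** * Lower bound: the weighted instance and its optima *)

Section Weights.
Variables m k : nat.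
Local Notation n := (m.+1 + (3 + k))%N.

Definition clique (i : 'I_m.+1) : 'I_n := lshift (3 + k) i.
Definition pendant (j : 'I_3) : 'I_n := rshift m.+1 (lshift k j).
Definition spare (j : 'I_k) : 'I_n := rshift m.+1 (rshift 3 j).

Variant vertex_spec : 'I_n -> Prop :=
  | VertexClique i : vertex_spec (clique i)
  | VertexPendant j : vertex_spec (pendant j)
  | VertexSpare j : vertex_spec (spare j).

Lemma vertexP x : vertex_spec x.
Proof.
by case: (split_ordP x) => i ->; [| case: (split_ordP i) => j ->]; constructor.
Qed.

Lemma big_vertex (V : nmodType) (F : 'I_n -> V) :
  \sum_x F x = \sum_i F (clique i) + \sum_j F (pendant j) + \sum_j F (spare j).
Proof. by rewrite big_split_ord /= big_split_ord /= addrA. Qed.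

Definition vertex_fun (V : Type) (a : 'I_m.+1 -> V) (b : 'I_3 -> V) (c : V)
    (x : 'I_n) : V :=
  match split x with
  | inl i => a i
  | inr y => match split y with inl j => b j | inr _ => c end
  end.

Lemma vertex_fun_clique V a b c i : @vertex_fun V a b c (clique i) = a i.
Proof. by rewrite /vertex_fun (unsplitK (inl i)). Qed.

Lemma vertex_fun_pendant V a b c j : @vertex_fun V a b c (pendant j) = b j.
Proof.
by rewrite /vertex_fun (unsplitK (inr (lshift k j))) (unsplitK (inl j)).
Qed.

Lemma vertex_fun_spare V a b c j : @vertex_fun V a b c (spare j) = c.
Proof.
by rewrite /vertex_fun (unsplitK (inr (rshift 3 j))) (unsplitK (inr j)).
Qed.

Definition vertex_funE := (vertex_fun_clique, vertex_fun_pendant, vertex_fun_spare).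

(* Under unit stress on all edges between non-spare vertices, the weights are
   the Laplacian eigenvalues on the vectors of zero sum supported on the clique,
   respectively on the three pendants. *)
Definition weight : 'I_n -> nat := vertex_fun (fun=> m.+4) (fun=> m.+1) 0%N.
Definition unit_length (e : {set 'I_n}) : nat := 1%N.

Local Notation s := (fun x => (weight x)%:R : R).
Local Notation l := (fun e => (unit_length e)%:R : R).
Local Notation G := (Gmk m.+1 (3 + k)).
Local Notation M := (m.+1%:R : R).

(** Values in an arbitrary module let the same formula serve the barycentre and, over [R^o], the
    objective. *)
Lemma weight_sum (V : lmodType R) (F : 'I_n -> V) :
  \sum_x s x *: F x = (M + 3) *: (\sum_i F (clique i)) + M *: \sum_j F (pendant j).
Proof.
rewrite big_vertex /weight [X in _ + X]big1 => [|j _]; last first.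
  by rewrite vertex_funE scale0r.
rewrite addr0 !scaler_sumr; congr (_ + _); apply: eq_bigr => i _.
  by rewrite vertex_funE -natrD addn3.
by rewrite vertex_funE.
Qed.

(** Ordered pairs are summed, so each clique edge counts twice. *)
Definition clique_slack (v : 'I_n -> 'rV[R]_n) : R :=
  \sum_i \sum_j ((i != j)%:R
    - dot (v (clique i) - v (clique j)) (v (clique i) - v (clique j))).

Definition pendant_slack (v : 'I_n -> 'rV[R]_n) : R :=
  \sum_j \sum_i (1
    - dot (v (pendant j) - v (clique i)) (v (pendant j) - v (clique i))).

(** The number of edges between non-spare vertices, all of length 1. *)
Definition optimum : R := M * (M - 1) / 2 + 3 * M.

(** The weights make the squared norms cancel against the expanded slacks. What remains is a
    multiple of |C|^2, since the barycentre condition makes the pendant sum -(M + 3) / M times C. *)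
Lemma duality_gap v : \sum_x s x *: v x = 0 ->
  objective s v + clique_slack v / 2 + pendant_slack v
    + (M + 6) / M * dot (\sum_i v (clique i)) (\sum_i v (clique i)) = optimum.
Proof.
rewrite weight_sum objective_dot.
set C := \sum_i v (clique i); set P := \sum_j _ => bary.
have M0 : M != 0 by rewrite pnatr_eq0.
set A := \sum_i dot (v (clique i)) (v (clique i)).
set B := \sum_j dot (v (pendant j)) (v (pendant j)).
have -> : \sum_x s x * dot (v x) (v x) = (M + 3) * A + M * B.
  exact: (@weight_sum R^o (fun x => dot (v x) (v x))).
have -> : clique_slack v = M * (M - 1) - 2 * (M * A - dot C C).
  rewrite /clique_slack; under eq_bigr => i _.
    rewrite sumrB sum_sqr_dist -/A -/C (bigD1 i) //= eqxx add0r.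
    rewrite (eq_bigr (fun=> 1)) => [|j]; last by rewrite eq_sym => ->.
    rewrite sumr_const cardC1 card_ord /=.
    over.
  rewrite !(big_split, sumrN, sumrB) /= -!mulr_sumr !sumr_const !card_ord.
  rewrite -dot_suml -/A -/C; ring.
have -> : pendant_slack v = 3 * M - (M * B + 3 * A - 2 * dot P C).
  rewrite /pendant_slack; under eq_bigr => j _.
    rewrite sumrB sum_sqr_dist -/A -/C sumr_const card_ord.
    over.
  rewrite !(big_split, sumrN, sumrB) /= -!mulr_sumr !sumr_const !card_ord.
  rewrite -dot_suml -/B -/P; ring.
have -> : dot P C = - (M + 3) / M * dot C C.
  have /(congr1 (fun x => dot x C)) := bary; rewrite dot0l !dotE => h.
  apply: (mulfI M0).
  by rewrite [RHS](_ : _ = - ((M + 3) * dot C C)); [lra | by move: M0; move: M => q q0; field].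
by rewrite /optimum; move: M0; move: M => q q0; field.
Qed.

Lemma clique_slack_ge0 v : feasible G s l v -> forall i j, 0 <= (i != j)%:R
  - dot (v (clique i) - v (clique j)) (v (clique i) - v (clique j)).
Proof.
move=> [_ hl] i j; have [->|ij] := eqVneq i j; first by rewrite subrr dot0l subrr.
rewrite subr_ge0 -[true%:R](expr1n _ 2) -enorm_le //; apply: hl.
by rewrite /= /Gmk_adj (inj_eq (@lshift_inj _ _)) ij /= ltn_ord.
Qed.

Lemma pendant_slack_ge0 v : feasible G s l v -> forall j i, 0 <= 1
  - dot (v (pendant j) - v (clique i)) (v (pendant j) - v (clique i)).
Proof.
move=> [_ hl] j i; rewrite subr_ge0 -[1](expr1n _ 2) -enorm_le //; apply: hl.
by rewrite /= /Gmk_adj eq_rlshift /= ltn_ord orbT.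
Qed.

Lemma objective_le_optimum v : feasible G s l v -> objective s v <= optimum.
Proof.
move=> hv; have h1 : 0 <= clique_slack v.
  by do 2![apply: sumr_ge0 => ? _]; apply: clique_slack_ge0.
have h2 : 0 <= pendant_slack v.
  by do 2![apply: sumr_ge0 => ? _]; apply: pendant_slack_ge0.
have h3 : 0 <= (M + 6) / M * dot (\sum_i v (clique i)) (\sum_i v (clique i)).
  by rewrite mulr_ge0 ?dot_ge0 ?divr_ge0 ?addr_ge0.
by rewrite -(duality_gap (proj1 hv)) -!addrA lerDl !addr_ge0 // divr_ge0.
Qed.

(** Two thirds of it is the squared pendant norm (M + 1) / (2 M), that is, 1 minus the squared
    clique norm (M - 1) / (2 M). *)
Definition pendant_scale : R := 3 * (M + 1) / (4 * M).

Definition simplex_gram (v : 'I_n -> 'rV[R]_n) :=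
  [/\ forall i j, dot (v (clique i)) (v (clique j)) = 2^-1 * ((i == j)%:R - M^-1),
      forall i j, dot (v (pendant i)) (v (pendant j))
        = pendant_scale * ((i == j)%:R - 3^-1) &
      forall i j, dot (v (clique i)) (v (pendant j)) = 0].

(** Equality in the gap identity makes every slack and C vanish; with both sums zero, the unit
    distances determine all the inner products. *)
Lemma optimum_simplex_gram v :
  feasible G s l v -> objective s v = optimum -> simplex_gram v.
Proof.
move=> hv hobj; have gap := duality_gap (proj1 hv).
have e1 := clique_slack_ge0 hv; have e2 := pendant_slack_ge0 hv.
have h1 : 0 <= clique_slack v by do 2![apply: sumr_ge0 => ? _].
have h2 : 0 <= pendant_slack v by do 2![apply: sumr_ge0 => ? _].
have M0 : 0 < M by rewrite ltr0n.
have M1 : M != 0 by rewrite gt_eqF.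
have q0 : 0 < (M + 6) / M by rewrite divr_gt0 ?addr_gt0.
set C := \sum_i v (clique i) in gap.
have h3 : 0 <= (M + 6) / M * dot C C by rewrite mulr_ge0 ?dot_ge0 // ltW.
rewrite hobj in gap; move: gap h1 h2 h3; set T := _ / M * _ => gap h1 h2 h3.
have C0 : C = 0.
  apply: dot_eq0; apply: (mulfI (lt0r_neq0 q0)); rewrite mulr0 -/T; lra.
have {h1}h1 : clique_slack v = 0 by lra.
have {h2}h2 : pendant_slack v = 0 by lra.
have {}e1 i j : dot (v (clique i) - v (clique j)) (v (clique i) - v (clique j))
    = (i != j)%:R.
  by apply/esym/eqP; rewrite -subr_eq0 (psumr2_eq0 e1 h1).
have {}e2 j i :
    dot (v (pendant j) - v (clique i)) (v (pendant j) - v (clique i)) = 1.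
  by apply/esym/eqP; rewrite -subr_eq0 (psumr2_eq0 e2 h2).
have [_ P0] : C = 0 /\ \sum_j v (pendant j) = 0.
  split=> //; have := proj1 hv; rewrite weight_sum -/C C0 scaler0 add0r => /eqP.
  by rewrite scaler_eq0 (negPf M1) => /eqP.
set A := \sum_i dot (v (clique i)) (v (clique i)).
(* The squared distances from one clique vertex are summed; a further sum over [i] gives [A], and
   then each norm. *)
have s1 i : M * dot (v (clique i)) (v (clique i)) + A = M - 1.
  have := sum_sqr_dist (v (clique i)) (fun j => v (clique j)).
  rewrite -/A -/C C0 dot0r mulr0 subr0 => <-.
  under eq_bigr do rewrite e1.
  rewrite (bigD1 i) //= eqxx add0r (eq_bigr (fun=> 1)) => [|j]; last first.
    by rewrite eq_sym => ->.
  by rewrite sumr_const cardC1 card_ord /= -natr1 addrK.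
have hA : A = (M - 1) / 2.
  have : \sum_i (M * dot (v (clique i)) (v (clique i)) + A) = M * (M - 1).
    by under eq_bigr do rewrite s1; rewrite sumr_const card_ord mulr_natl.
  rewrite big_split /= -mulr_sumr -/A sumr_const card_ord -[A *+ _]mulr_natl => h.
  apply: (mulfI M1); lra.
have n1 i : dot (v (clique i)) (v (clique i)) = (M - 1) / (2 * M).
  apply: (mulfI M1); have := s1 i; rewrite hA => h.
  rewrite [RHS](_ : _ = (M - 1) / 2); first by lra.
  by move: M1; move: M => q q1; field.
have n2 j : dot (v (pendant j)) (v (pendant j)) = (M + 1) / (2 * M).
  have := sum_sqr_dist (v (pendant j)) (fun i => v (clique i)).
  rewrite -/A -/C C0 dot0r mulr0 subr0 hA.
  under eq_bigr do rewrite e2.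
  rewrite sumr_const card_ord => h; apply: (mulfI M1).
  rewrite [RHS](_ : _ = (M + 1) / 2); first by lra.
  by move: M1; move: M => q q1; field.
split.
- move=> i j; have [->|ij] := eqVneq i j.
    by rewrite n1 /=; move: M1; move: M => q q1; field.
  have := e1 i j; rewrite dot_sub !n1 ij /= => h.
  have -> : dot (v (clique i)) (v (clique j)) = (M - 1) / (2 * M) - 2^-1.
    by move: h; set r := _ / (2 * M) => h; lra.
  by move=> /=; move: M1; move: M => q q1; field.
- have hq : (M + 1) / (2 * M) = pendant_scale * (2 / 3).
    by rewrite /pendant_scale; move: M1; move: M => q q1; field.
  by apply: dot_triangle => // j; rewrite n2 hq.
(* The squared norms add up to the squared distance 1, so the inner product vanishes. *)
- move=> i j; have := e2 j i; rewrite dot_sub n1 n2 dotC.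
  have : (M + 1) / (2 * M) + (M - 1) / (2 * M) = 1.
    by move: M1; move: M => q q1; field.
  by set r1 := (M + 1) / _; set r2 := (M - 1) / _; lra.
Qed.

Definition simplex_embedding : 'I_n -> 'rV[R]_n :=
  vertex_fun (simplex clique (Num.sqrt 2^-1))
    (simplex pendant (Num.sqrt pendant_scale)) 0.

Lemma simplex_embedding_gram : simplex_gram simplex_embedding.
Proof.
rewrite /simplex_embedding; split=> i j; rewrite !vertex_funE.
- by rewrite dot_simplex ?sqr_sqrtr ?invr_ge0 //; apply: lshift_inj.
- rewrite dot_simplex ?sqr_sqrtr //; last by move=> x y /rshift_inj/lshift_inj.
  by rewrite divr_ge0 ?mulr_ge0 ?addr_ge0.
- by apply: dot_simplex_disjoint => x y; rewrite eq_lrshift.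
Qed.

Lemma simplex_embedding_feasible : feasible G s l simplex_embedding.
Proof.
have [g1 g2 g3] := simplex_embedding_gram.
have M1 : M != 0 by rewrite pnatr_eq0.
have M0 : 0 < M^-1 by rewrite invr_gt0 ltr0n.
have q0 : pendant_scale * (2 / 3) = (1 + M^-1) / 2.
  by rewrite /pendant_scale; move: M1; move: M => q q1; field.
split.
  rewrite weight_sum /simplex_embedding.
  under eq_bigr do rewrite vertex_funE.
  under [X in _ + _ *: X]eq_bigr do rewrite vertex_funE.
  by rewrite !sum_simplex !scaler0 addr0.
have cl i y : clique i != y ->
    enorm (simplex_embedding (clique i) - simplex_embedding y) <= 1.
  rewrite enorm_le // expr1n dot_sub.
  case: (vertexP y) => [j|j|j] ij.
  - have {}ij : i != j by apply: contra_neq ij => ->.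
    rewrite !g1 !eqxx (negPf ij) /=.
    by move: M0; move: M^-1 => r; lra.
  - rewrite g1 g2 g3 !eqxx /=.
    by move: M0 q0; move: pendant_scale M^-1 => p r; lra.
  - rewrite g1 [simplex_embedding (spare _)]vertex_funE !dot0r !eqxx /=.
    by move: M0; move: M^-1 => r; lra.
have clP (x : 'I_n) : (x < m.+1)%N -> exists i, x = clique i.
  case: (vertexP x) => [i|i|i] /=; first by exists i.
    by rewrite ltnNge leq_addr.
  by rewrite ltnNge leq_addr.
move=> x y /andP[xy /orP[/clP[i xi]|/clP[i yi]]].
  by rewrite xi in xy *; apply: cl.
rewrite yi eq_sym in xy *; rewrite enorm_le //.
have -> : simplex_embedding x - simplex_embedding (clique i)
  = - (simplex_embedding (clique i) - simplex_embedding x) by rewrite opprB.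
by rewrite dotNl dotNr opprK -enorm_le //; apply: cl.
Qed.

Lemma simplex_embedding_objective : objective s simplex_embedding = optimum.
Proof.
have [g1 g2 g3] := simplex_embedding_gram.
have M1 : M != 0 by rewrite pnatr_eq0.
rewrite objective_dot.
rewrite (@weight_sum R^o (fun x => dot (simplex_embedding x) (simplex_embedding x))).
under eq_bigr do rewrite g1 eqxx.
under [X in _ + _ *: X]eq_bigr do rewrite g2 eqxx.
rewrite !sumr_const !card_ord -!(mulr_natl (_ * _)) /GRing.scale /=.
by rewrite /optimum /pendant_scale; move: M1; move: M => q q1; field.
Qed.

Lemma simplex_embedding_optimal : optimal G s l simplex_embedding.
Proof.
split; first exact: simplex_embedding_feasible.
by move=> w hw; rewrite simplex_embedding_objective objective_le_optimum.
Qed.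

(** Every optimum attains [optimum], hence has the prescribed Gram matrix: the clique contributes
    [m], the triangle 2. *)
Lemma optimal_dim_ge v : optimal G s l v -> (m.+2 <= Defs.dim_span v)%N.
Proof.
move=> [hv /(_ _ simplex_embedding_feasible)].
rewrite simplex_embedding_objective => vopt.
have [|g1 g2 g3] := optimum_simplex_gram hv.
  by apply/eqP; rewrite eq_le vopt objective_le_optimum.
rewrite -addn2; apply: dim_simplices_ge g1 g2 g3; first by rewrite invr_eq0 pnatr_eq0.
by rewrite gt_eqF // divr_gt0 ?mulr_gt0 ?addr_gt0 ?ltr0n.
Qed.

End Weights.

End Example.

(** * Combining both bounds *)

Lemma optimal_low_dim (R : realType) (m k : nat) (s : 'I_(m.+1 + k.+1) -> nat)
    (l : {set 'I_(m.+1 + k.+1)} -> nat) v :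
  optimal (Gmk m.+1 k.+1) (fun i => (s i)%:R : R) (fun e => (l e)%:R) v ->
  exists2 v', optimal (Gmk m.+1 k.+1) (fun i => (s i)%:R : R) (fun e => (l e)%:R) v'
    & (Defs.dim_span v' <= m.+2)%N.
Proof.
move=> [hv vopt].
have [v' [hv' hobj hd]] :=
  dim_reduction (fun i => ler0n R (s i)) (fun e => ler0n R (l e)) hv.
by exists v' => //; split=> // w hw; rewrite hobj; apply: vopt.
Qed.

Theorem theorem4p3 (R : realType) (m k : nat)
    (hm : (4 <= m)%N) (hk : (3 <= k)%N) :
  rotdim R (Gmk m k) = m.+1.
Proof.
(* From here on the clique has [m.+1] vertices, so the target is [m.+2]. *)
case: m hm => // m _; rewrite -(subnKC hk); move: (k - 3)%N => {hk}k.
have ub s l : (rotdim_at (Gmk m.+1 (3 + k)) (fun i => (s i)%:R : R)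
    (fun e => (l e)%:R : R) <= m.+2)%N.
  (* If no minimum exists, [xget] returns 0, which also satisfies the bound. *)
  rewrite /rotdim_at; case: xgetP => // d _ [[v hv ->] dmin].
  have [v' hv' hd] := optimal_low_dim hv.
  by apply: leq_trans hd; apply: dmin; exists v'.
have lb : rotdim_at (Gmk m.+1 (3 + k)) (fun i => (weight i)%:R : R)
    (fun e => (unit_length e)%:R : R) = m.+2.
  apply/eqP; rewrite eqn_leq ub /rotdim_at /=.
  (* Reducing the simplex embedding gives an optimum of dimension exactly [m.+2], so the minimum
     exists. *)
  have [v hv hd] := optimal_low_dim (simplex_embedding_optimal R m k).
  have hmin : is_min (fun d => exists2 v, optimal (Gmk m.+1 (3 + k))
      (fun i => (weight i)%:R : R) (fun e => (unit_length e)%:R : R) v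
      & d = Defs.dim_span v) m.+2.
    split; last by move=> _ [w hw ->]; apply: optimal_dim_ge.
    by exists v => //; apply/eqP; rewrite eqn_leq hd andbT; apply: optimal_dim_ge.
  by have [[w hw ->] _] := xgetI 0%N hmin; apply: optimal_dim_ge.
apply: xget_unique.
  by split=> [|_ [s [l ->]] //]; exists (@weight m k), (@unit_length m k).
move=> d [[s [l ->]] dmax]; apply/eqP; rewrite eqn_leq ub /=.
by apply: dmax; exists (@weight m k), (@unit_length m k).
Qed.
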